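(* Let $\{X_s,\|\cdot\|_s\}_{s\in\mathbb N_0}$ be a sequence of Banach spaces satisfying (F1)–(F3), $\{\Theta_s,|||\cdot|||_s\}_{s\in\mathbb N_0}$ a sequence of $\lambda_s$–$BK$-spaces satisfying (F1)–(F3), and let $\{g_i\}_{i=1}^\infty\in(X_F^* )^{\mathbb N}$ be an $F$-frame for $X_F$ with respect to $\Theta_F$. Then: (a) for every $s\in\mathbb N_0$, $\{g_i^s\}_{i=1}^\infty$ is a Banach frame for $X_s$ with respect to $\Theta_s$; (b) if all $\Theta_s$ are $CB$-spaces, there exists $\{f_i\}_{i=1}^\infty\in (X_F)^{\mathbb N}$ which is a $DF$-Bessel sequence for $X_F^*$ with respect to $\Theta_F^*$ such that $f=\sum_{i=1}^\infty g_i(f)f_i$ for all $f\in X_F$ (convergence in $X_F$), $g=\sum_{i=1}^\infty g(f_i)g_i$ for all $g\in X_F^*$ (convergence in $X_F^*$), and $f=\sum_{i=1}^\infty g_i^s(f)f_i$ for all $f\in X_s$, $s\in\mathbb N_0$ (convergence in $X_s$); (c) if all $\Theta_s$ and $\Theta_s^*$ are $CB$-spaces, there exists $\{f_i\}\in(X_F)^{\mathbb N}$ which is a pre-$DF$-frame for $X_F^*$ with respect to $\Theta_F^*$ satisfying the three expansions in (b) and moreover $g=\sum_{i=1}^\infty g(f_i)g_i^s$ for all $g\in X_s^*$, $s\in\mathbb N_0$; (d) if all $\Theta_s$ are reflexive $CB$-spaces, there exists $\{f_i\}\in(X_F)^{\mathbb N}$ which is a $DF$-frame for $X_F^*$ with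 respect to $\Theta_F^*$ satisfying all four expansions in (b) and (c).
   Context: Conditions (F1)–(F3) for a sequence $\{Y_s,|\cdot|_s\}_{s\in\mathbb N_0}$ of separable Banach spaces: (F1) $\{0\}\neq\bigcap_sY_s\subseteq\dots\subseteq Y_1\subseteq Y_0$; (F2) $|\cdot|_0\le|\cdot|_1\le\dots$; (F3) $Y_F:=\bigcap_sY_s$ dense in each $Y_s$. $X_F=\bigcap_sX_s$, $\Theta_F=\bigcap_s\Theta_s$. $BK$-space: Banach sequence space with continuous coordinate functionals; $\lambda$–$BK$-space: $BK$-space containing the canonical vectors $e_i$ with $|||\sum_{i=1}^nc_ie_i|||\le\lambda|||\{c_i\}|||$; $CB$-space: $BK$-space in which the canonical vectors form a Schauder basis. For a $CB$-space $\Theta$, $\Theta^*$ is identified with the $BK$-space $\{\{g(e_i)\}_{i=1}^\infty:g\in\Theta^*\}$ normed by $|||\{g(e_i)\}|||:=\|g\|_{\Theta^*}$. For a Banach space $X$ and $BK$-space $\Theta$: $\{g_i\}\subset X^*$ is a $\Theta$-Bessel sequence if $\{g_i(f)\}\in\Theta$ and $|||\{g_i(f)\}|||\le B\|f\|$ for all $f\in X$; a $\Theta$-frame if moreover $A\|f\|\le|||\{g_i(f)\}|||$ with $A>0$; a Banach frame w.r.t. $\Theta$ if it is a $\Theta$-frame and there is a bounded operator $V:\Theta\to X$ with $V(\{g_i(f)\})=f$, $f\in X$. (For $\{f_i\}\subset X\subseteq X^{**}$ these notions are applied to $X^*$ via $g\mapsto\{g(f_i)\}$.) Pre-$F$-frame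 / $F$-Bessel / $F$-frame: $\{g_i\}\in(X_F^* )^{\mathbb N}$ with $\{g_i(f)\}\in\Theta_F$ for $f\in X_F$ and for each $s$ constants $0<A_s\le B_s$ with $A_s\|f\|_s\le|||\{g_i(f)\}|||_s\le B_s\|f\|_s$ (pre-$F$-frame; only the upper inequality: $F$-Bessel); an $F$-frame is a pre-$F$-frame with an $F$-bounded $V:\Theta_F\to X_F$, $V(\{g_i(f)\})=f$ for $f\in X_F$, where $F$-bounded means $\|Vc\|_s\le K_s|||c|||_s$ for each $s$. For an $F$-Bessel sequence, $g_i^s\in X_s^*$ denotes the unique continuous extension of $g_i$ from $X_F$ to $X_s$. When all $\Theta_s$ are $CB$-spaces, $\{f_i\}\in(X_F)^{\mathbb N}$ is a $DF$-Bessel sequence (resp. pre-$DF$-frame, resp. $DF$-frame) for $X_F^*$ w.r.t. $\Theta_F^*$ if for every $s$ it is a $\Theta_s^*$-Bessel sequence (resp. $\Theta_s^*$-frame, resp. Banach frame w.r.t. $\Theta_s^*$) for $X_s^*$.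
   Formalization: Convergence in X_F^* is taken as weak-* (pointwise on X_F): strong convergence fails in (b), e.g. all X_s = Θ_s = ℓ^1 with the coordinate functionals; in (c) and (d) strong convergence follows from the norm expansions in X_s^*. *)

(* Defs.v *)
From Stdlib Require Import Reals Lra FunctionalExtensionality ClassicalEpsilon.
Open Scope R_scope.

Record VSpace := {
  vcar :> Type;
  vzero : vcar;
  vadd : vcar -> vcar -> vcar;
  vopp : vcar -> vcar;
  vscal : R -> vcar -> vcar;
  vaddA : forall x y z, vadd x (vadd y z) = vadd (vadd x y) z;
  vaddC : forall x y, vadd x y = vadd y x;
  vadd0 : forall x, vadd x vzero = x;
  vaddN : forall x, vadd x (vopp x) = vzero;
  vscal1 : forall x, vscal 1 x = x;
  vscalA : forall a b x, vscal a (vscal b x) = vscal (a * b) x;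
  vscalDr : forall a x y, vscal a (vadd x y) = vadd (vscal a x) (vscal a y);
  vscalDl : forall a b x, vscal (a + b) x = vadd (vscal a x) (vscal b x)
}.
Arguments vzero {_}.
Arguments vadd {_}.
Arguments vopp {_}.
Arguments vscal {_}.

Definition vsub {V : VSpace} (x y : V) : V := vadd x (vopp y).

Definition seqVS : VSpace.
Proof.
refine {| vcar := nat -> R; vzero := fun _ => 0;
          vadd := fun c d i => c i + d i; vopp := fun c i => - c i;
          vscal := fun a c i => a * c i |};
intros; apply functional_extensionality; intros; ring.
Defined.

Fixpoint vsum {V : VSpace} (u : nat -> V) (n : nat) : V :=
  match n with O => vzero | S m => vadd (vsum u m) (u m) end.
Fixpoint rsum (u : nat -> R) (n : nat) : R :=
  match n with O => 0 | S m => rsum u m + u m end.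

(* supremum of a set of reals (0 if empty or unbounded) *)
Definition Rsup (E : R -> Prop) : R :=
  match excluded_middle_informative (bound E /\ exists x, E x) with
  | left h => proj1_sig (completeness E (proj1 h) (proj2 h))
  | right _ => 0
  end.

(* ---------- Banach (sub)spaces: a subset P of V normed by n ---------- *)
Definition subspace {V : VSpace} (P : V -> Prop) : Prop :=
  P vzero /\ (forall x y, P x -> P y -> P (vadd x y)) /\
  (forall a x, P x -> P (vscal a x)).

Definition is_norm_on {V : VSpace} (P : V -> Prop) (n : V -> R) : Prop :=
  (forall x, P x -> 0 <= n x) /\
  (forall x, P x -> n x = 0 -> x = vzero) /\
  (forall a x, P x -> n (vscal a x) = Rabs a * n x) /\
  (forall x y, P x -> P y -> n (vadd x y) <= n x + n y).

Definition conv_in {V : VSpace} (n : V -> R) (u : nat -> V) (l : V) : Prop :=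
  forall eps, eps > 0 -> exists N, forall p, (N <= p)%nat -> n (vsub (u p) l) < eps.

Definition cauchy_in {V : VSpace} (P : V -> Prop) (n : V -> R) (u : nat -> V) : Prop :=
  (forall k, P (u k)) /\
  forall eps, eps > 0 -> exists N, forall p q, (N <= p)%nat -> (N <= q)%nat ->
    n (vsub (u p) (u q)) < eps.

Definition complete_in {V : VSpace} (P : V -> Prop) (n : V -> R) : Prop :=
  forall u, cauchy_in P n u -> exists l, P l /\ conv_in n u l.

Definition separable_in {V : VSpace} (P : V -> Prop) (n : V -> R) : Prop :=
  exists d : nat -> V, (forall k, P (d k)) /\
    forall x, P x -> forall eps, eps > 0 -> exists k, n (vsub x (d k)) < eps.

Definition Banach_in {V : VSpace} (P : V -> Prop) (n : V -> R) : Prop :=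
  subspace P /\ is_norm_on P n /\ complete_in P n /\ separable_in P n.

Definition PF {V : VSpace} (P : nat -> V -> Prop) (x : V) : Prop := forall s, P s x.

Definition FFamily {V : VSpace} (P : nat -> V -> Prop) (n : nat -> V -> R) : Prop :=
  (forall s, Banach_in (P s) (n s)) /\
  (forall s x, P (S s) x -> P s x) /\ (exists x, x <> vzero /\ PF P x) /\
  (forall s x, P (S s) x -> n s x <= n (S s) x) /\
  (forall s x, P s x -> forall eps, eps > 0 -> exists y, PF P y /\ n s (vsub x y) < eps).

Definition lin_on {V : VSpace} (P : V -> Prop) (g : V -> R) : Prop :=
  forall a b x y, P x -> P y -> g (vadd (vscal a x) (vscal b y)) = a * g x + b * g y.

Definition in_dual {V : VSpace} (P : V -> Prop) (n : V -> R) (g : V -> R) : Prop :=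
  lin_on P g /\ exists C, forall x, P x -> Rabs (g x) <= C * n x.

Definition dual_norm {V : VSpace} (P : V -> Prop) (n : V -> R) (g : V -> R) : R :=
  Rsup (fun r => exists x, P x /\ n x <= 1 /\ r = Rabs (g x)).

(* g belongs to X_F^* : linear on X_F, continuous for the Frechet topology *)
Definition in_dualF {V : VSpace} (P : nat -> V -> Prop) (n : nat -> V -> R) (g : V -> R) : Prop :=
  lin_on (PF P) g /\ exists s C, forall x, PF P x -> Rabs (g x) <= C * n s x.

(* h is the (unique) continuous extension g^s of g from X_F to X_s *)
Definition is_ext {V : VSpace} (P : nat -> V -> Prop) (n : nat -> V -> R) (s : nat)
  (g h : V -> R) : Prop :=
  in_dual (P s) (n s) h /\ forall x, PF P x -> h x = g x.

Definition ecan (i : nat) : nat -> R := fun j => if Nat.eqb i j then 1 else 0.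
Definition trunc (n : nat) (c : nat -> R) : nat -> R := fun j => if Nat.ltb j n then c j else 0.

Definition BK_space (Th : (nat -> R) -> Prop) (tn : (nat -> R) -> R) : Prop :=
  @Banach_in seqVS Th tn /\
  forall i, exists K, forall c, Th c -> Rabs (c i) <= K * tn c.

Definition lamBK (Th : (nat -> R) -> Prop) (tn : (nat -> R) -> R) (lam : R) : Prop :=
  BK_space Th tn /\ (forall i, Th (ecan i)) /\
  forall n c, Th c -> tn (trunc n c) <= lam * tn c.

Definition CB_space (Th : (nat -> R) -> Prop) (tn : (nat -> R) -> R) : Prop :=
  BK_space Th tn /\ (forall i, Th (ecan i)) /\
  forall c, Th c -> @conv_in seqVS tn (fun n => trunc n c) c.

(* Theta^* identified with { {g(e_i)} : g in Theta^* }, normed by ||g|| *)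
Definition dseq_mem (Th : (nat -> R) -> Prop) (tn : (nat -> R) -> R) (d : nat -> R) : Prop :=
  exists g, @in_dual seqVS Th tn g /\ forall i, d i = g (ecan i).

Definition dseq_norm (Th : (nat -> R) -> Prop) (tn : (nat -> R) -> R) (d : nat -> R) : R :=
  Rsup (fun r => exists g, @in_dual seqVS Th tn g /\ (forall i, d i = g (ecan i)) /\
                   exists c, Th c /\ tn c <= 1 /\ r = Rabs (g c)).

Definition reflexive_seq (Th : (nat -> R) -> Prop) (tn : (nat -> R) -> R) : Prop :=
  forall Phi : ((nat -> R) -> R) -> R,
    (forall a b g h, @in_dual seqVS Th tn g -> @in_dual seqVS Th tn h ->
       Phi (fun c => a * g c + b * h c) = a * Phi g + b * Phi h) ->
    (exists C, forall g, @in_dual seqVS Th tn g -> Rabs (Phi g) <= C * @dual_norm seqVS Th tn g) ->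
    exists c, Th c /\ forall g, @in_dual seqVS Th tn g -> Phi g = g c.

Definition Banach_frame {V : VSpace} (P : V -> Prop) (n : V -> R)
  (Th : (nat -> R) -> Prop) (tn : (nat -> R) -> R) (g : nat -> V -> R) : Prop :=
  (forall i, in_dual P n (g i)) /\
  (forall f, P f -> Th (fun i => g i f)) /\
  (exists A B, 0 < A /\ forall f, P f ->
     A * n f <= tn (fun i => g i f) /\ tn (fun i => g i f) <= B * n f) /\
  (exists U : (nat -> R) -> V,
     (forall c, Th c -> P (U c)) /\
     (forall a b c d, Th c -> Th d ->
        U (fun i => a * c i + b * d i) = vadd (vscal a (U c)) (vscal b (U d))) /\
     (exists K, forall c, Th c -> n (U c) <= K * tn c) /\
     (forall f, P f -> U (fun i => g i f) = f)).

(* {f_i} in X viewed in X^** : Theta^*-Bessel / Theta^*-frame / Banach frame for X^* *)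
Definition dBessel {V : VSpace} (P : V -> Prop) (n : V -> R)
  (Th : (nat -> R) -> Prop) (tn : (nat -> R) -> R) (f : nat -> V) : Prop :=
  (forall g, in_dual P n g -> dseq_mem Th tn (fun i => g (f i))) /\
  exists B, forall g, in_dual P n g ->
    dseq_norm Th tn (fun i => g (f i)) <= B * dual_norm P n g.

Definition dFrame {V : VSpace} (P : V -> Prop) (n : V -> R)
  (Th : (nat -> R) -> Prop) (tn : (nat -> R) -> R) (f : nat -> V) : Prop :=
  dBessel P n Th tn f /\
  exists A, 0 < A /\ forall g, in_dual P n g ->
    A * dual_norm P n g <= dseq_norm Th tn (fun i => g (f i)).

Definition dBanach_frame {V : VSpace} (P : V -> Prop) (n : V -> R)
  (Th : (nat -> R) -> Prop) (tn : (nat -> R) -> R) (f : nat -> V) : Prop :=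
  dFrame P n Th tn f /\
  exists U : (nat -> R) -> (V -> R),
    (forall d, dseq_mem Th tn d -> in_dual P n (U d)) /\
    (forall a b d1 d2, dseq_mem Th tn d1 -> dseq_mem Th tn d2 -> forall x, P x ->
        U (fun i => a * d1 i + b * d2 i) x = a * U d1 x + b * U d2 x) /\
    (exists K, forall d, dseq_mem Th tn d -> dual_norm P n (U d) <= K * dseq_norm Th tn d) /\
    (forall g, in_dual P n g -> forall x, P x -> U (fun i => g (f i)) x = g x).

Definition pre_F_frame {V : VSpace} (P : nat -> V -> Prop) (n : nat -> V -> R)
  (Th : nat -> (nat -> R) -> Prop) (tn : nat -> (nat -> R) -> R) (g : nat -> V -> R) : Prop :=
  (forall i, in_dualF P n (g i)) /\
  (forall f, PF P f -> @PF seqVS Th (fun i => g i f)) /\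
  (forall s, exists A B, 0 < A /\ A <= B /\ forall f, PF P f ->
     A * n s f <= tn s (fun i => g i f) /\ tn s (fun i => g i f) <= B * n s f).

Definition F_frame {V : VSpace} (P : nat -> V -> Prop) (n : nat -> V -> R)
  (Th : nat -> (nat -> R) -> Prop) (tn : nat -> (nat -> R) -> R) (g : nat -> V -> R) : Prop :=
  pre_F_frame P n Th tn g /\
  exists U : (nat -> R) -> V,
    (forall c, @PF seqVS Th c -> PF P (U c)) /\
    (forall a b c d, @PF seqVS Th c -> @PF seqVS Th d ->
        U (fun i => a * c i + b * d i) = vadd (vscal a (U c)) (vscal b (U d))) /\
    (forall s, exists K, forall c, @PF seqVS Th c -> n s (U c) <= K * tn s c) /\
    (forall f, PF P f -> U (fun i => g i f) = f).

Definition DF_Bessel {V : VSpace} (P : nat -> V -> Prop) (n : nat -> V -> R)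
  (Th : nat -> (nat -> R) -> Prop) (tn : nat -> (nat -> R) -> R) (f : nat -> V) : Prop :=
  (forall i, PF P (f i)) /\ forall s, dBessel (P s) (n s) (Th s) (tn s) f.

Definition pre_DF_frame {V : VSpace} (P : nat -> V -> Prop) (n : nat -> V -> R)
  (Th : nat -> (nat -> R) -> Prop) (tn : nat -> (nat -> R) -> R) (f : nat -> V) : Prop :=
  (forall i, PF P (f i)) /\ forall s, dFrame (P s) (n s) (Th s) (tn s) f.

Definition DF_frame {V : VSpace} (P : nat -> V -> Prop) (n : nat -> V -> R)
  (Th : nat -> (nat -> R) -> Prop) (tn : nat -> (nat -> R) -> R) (f : nat -> V) : Prop :=
  (forall i, PF P (f i)) /\ forall s, dBanach_frame (P s) (n s) (Th s) (tn s) f.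

Definition exp_XF {V : VSpace} (P : nat -> V -> Prop) (n : nat -> V -> R)
  (g : nat -> V -> R) (f : nat -> V) : Prop :=
  forall x, PF P x -> forall s,
    conv_in (n s) (fun m => vsum (fun i => vscal (g i x) (f i)) m) x.

(* h = sum h(f_i) g_i in X_F^* (weak-* : pointwise on X_F) *)
Definition exp_XFdual {V : VSpace} (P : nat -> V -> Prop) (n : nat -> V -> R)
  (g : nat -> V -> R) (f : nat -> V) : Prop :=
  forall h, in_dualF P n h -> forall x, PF P x ->
    Un_cv (fun m => rsum (fun i => h (f i) * g i x) m) (h x).

Definition exp_Xs {V : VSpace} (P : nat -> V -> Prop) (n : nat -> V -> R)
  (g : nat -> V -> R) (f : nat -> V) : Prop :=
  forall s (gs : nat -> V -> R), (forall i, is_ext P n s (g i) (gs i)) ->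
  forall x, P s x -> conv_in (n s) (fun m => vsum (fun i => vscal (gs i x) (f i)) m) x.

Definition exp_Xsdual {V : VSpace} (P : nat -> V -> Prop) (n : nat -> V -> R)
  (g : nat -> V -> R) (f : nat -> V) : Prop :=
  forall s (gs : nat -> V -> R), (forall i, is_ext P n s (g i) (gs i)) ->
  forall h, in_dual (P s) (n s) h ->
    Un_cv (fun m => dual_norm (P s) (n s)
             (fun x => h x - rsum (fun i => h (f i) * gs i x) m)) 0.

(* Main.v *)
(* For each s the analysis map x |-> (g_i(x))_i and the synthesis map V extend by
   density to bounded operators C_s : X_s -> Theta_s and U_s : Theta_s -> X_s with
   U_s C_s = id, which is (a). With f_i = V(e_i), the expansions in X_s are the images
   under U_s of the convergence of truncations in Theta_s, and those in X_s^* follow by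
   composing h o U_s in Theta_s^* with C_s, provided the coordinate functionals form a
   basis of Theta_s^*. That holds by hypothesis in (c) and by reflexivity in (d). *)
Require Import Defs.
From Stdlib Require Import Reals Lra Lia.
From Stdlib Require Import FunctionalExtensionality PropExtensionality.
From Stdlib Require Import Classical ClassicalEpsilon.
From mathcomp Require filter.
Open Scope R_scope.

(** * Generalized limits of bounded sequences *)

(** The hypotheses of (c) and (d) meet in one property, [shrinking]: the partial sums of every
    functional on Theta_s in the coordinate functionals converge in dual norm. In (c) it is a
    translation of the basis property of the sequence space Theta_s^*. In (d) it must be extracted
    from reflexivity. The usual route takes a weak limit point of a bounded sequence of blocks; here
    an ultrafilter limit of the values on the blocks directly defines an element of the bidual, to
    which reflexivity applies. One sequence [f] serves all levels, since every U_s extends the same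
    V and hence sends e_i to V(e_i). All lower frame bounds come from factorizations: x = U_s (C_s
    x) for X_s, and h = (h o U_s) o C_s on X_s for its dual. *)

Lemma nonprincipal_ultrafilter : exists F : (nat -> Prop) -> Prop,
  (forall A B, F A -> F B -> F (fun k => A k /\ B k)) /\
  (forall A B : nat -> Prop, (forall k, A k -> B k) -> F A -> F B) /\
  (forall A, F A \/ F (fun k => ~ A k)) /\
  (forall A, F A -> exists k, A k) /\
  (forall N, F (fun k => (N <= k)%nat)).
Proof.
(* The Fréchet filter of cofinite sets; an ultrafilter containing it is nonprincipal. *)
set (G := fun A : nat -> Prop => exists N, forall k, (N <= k)%nat -> A k).
assert (HG : filter.ProperFilter G).
{ split.
  - intros [N HN]. exact (HN N (le_n N)).
  - split.
    + exists 0%nat. intros k _. exact I.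
    + intros A B [N HN] [M HM]. exists (N + M)%nat. intros k Hk.
      split; [apply HN | apply HM]; lia.
    + intros A B HAB [N HN]. exists N. intros k Hk. apply HAB, HN, Hk. }
destruct (filter.ultraFilterLemma HG) as (F & HF & HGF).
pose proof (filter.ultra_proper (UltraFilter := HF)) as HP.
pose proof (filter.filter_filter (ProperFilter := HP)) as HFF.
exists F. repeat split.
- intros A B HA HB. exact (filter.filterI (Filter := HFF) HA HB).
- intros A B HAB HA. exact (filter.filterS (Filter := HFF) HAB HA).
- intros A. exact (filter.in_ultra_setVsetC A HF).
- intros A HA. apply NNPP. intros Hn. apply (filter.filter_not_empty F).
  refine (filter.filterS (Filter := HFF) _ HA).
  intros k Hk. apply Hn. exists k. exact Hk.
- intros N. apply HGF. exists N. intros k Hk. exact Hk.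
Qed.

Definition bounded_seq (u : nat -> R) : Prop := exists M, forall k, Rabs (u k) <= M.

(** The limit along a nonprincipal ultrafilter. Since the cutoff [N] is free, [L] depends only on
    the tail of a sequence; this is what will annihilate the coordinates of vectors whose supports
    move to infinity. *)
Lemma generalized_limit : exists L : (nat -> R) -> R,
  (forall a b u v, bounded_seq u -> bounded_seq v ->
     L (fun k => a * u k + b * v k) = a * L u + b * L v) /\
  (forall u c d N, bounded_seq u -> (forall k, (N <= k)%nat -> c <= u k <= d) -> c <= L u <= d).
Proof.
destruct nonprincipal_ultrafilter as (F & FI & FS & FU & FE & FN).
set (ul := fun (u : nat -> R) l => forall eps, eps > 0 -> F (fun k => Rabs (u k - l) < eps)).
assert (Uex : forall u, bounded_seq u -> exists l, ul u l).
{ intros u [M HM].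
  (* The limit is the supremum of the reals that bound [u] from below on a set of [F]. *)
  set (E := fun r => F (fun k => r <= u k)).
  assert (Eb : bound E).
  { exists M. intros r Hr. destruct (FE _ Hr) as [k Hk].
    pose proof (Rle_abs (u k)). specialize (HM k). lra. }
  assert (En : exists r, E r).
  { exists (- M). apply (FS (fun k => (0 <= k)%nat)); [|apply FN].
    intros k _. specialize (HM k). revert HM. unfold Rabs. destruct Rcase_abs; lra. }
  destruct (completeness E Eb En) as [l [Hub Hlub]].
  exists l. intros eps Heps.
  assert (H1 : F (fun k => l - eps < u k)).
  { destruct (classic (exists r, E r /\ l - eps < r)) as [(r & Hr & Hlr) | Hn].
    - apply (FS _ _) with (2 := Hr). intros k Hk. lra.
    - exfalso. assert (l <= l - eps); [|lra].
      apply Hlub. intros r Hr. apply Rnot_lt_le. intros Hlt. apply Hn. now exists r. }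
  assert (H2 : F (fun k => u k < l + eps)).
  { destruct (FU (fun k => l + eps <= u k)) as [H | H].
    - specialize (Hub _ H). lra.
    - apply (FS _ _) with (2 := H). intros k Hk. lra. }
  apply (FS _ _) with (2 := FI _ _ H1 H2).
  intros k [Ha Hb]. apply Rabs_def1; lra. }
assert (Ulin : forall a b u v l m, ul u l -> ul v m ->
          ul (fun k => a * u k + b * v k) (a * l + b * m)).
{ intros a b u v l m Hu Hv eps Heps.
  assert (Ha := Rabs_pos a). assert (Hb := Rabs_pos b).
  set (d := eps / (Rabs a + Rabs b + 1)).
  assert (Hd : d > 0) by (apply Rdiv_lt_0_compat; lra).
  apply (FS _ _) with (2 := FI _ _ (Hu d Hd) (Hv d Hd)).
  intros k [H1 H2].
  replace (a * u k + b * v k - (a * l + b * m)) with (a * (u k - l) + b * (v k - m)) by ring.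
  eapply Rle_lt_trans; [apply Rabs_triang|]. rewrite !Rabs_mult.
  assert (Rabs a * Rabs (u k - l) <= Rabs a * d) by (apply Rmult_le_compat_l; lra).
  assert (Rabs b * Rabs (v k - m) <= Rabs b * d) by (apply Rmult_le_compat_l; lra).
  assert (eps = Rabs a * d + Rabs b * d + d) by (unfold d; field; lra).
  lra. }
assert (Ubd : forall u l c d N, ul u l -> (forall k, (N <= k)%nat -> c <= u k <= d) -> c <= l <= d).
{ intros u l c d N Hu Hc. split; apply le_epsilon; intros eps Heps;
  destruct (FE _ (FI _ _ (FN N) (Hu eps Heps))) as (k & Hk & Hk');
  specialize (Hc k Hk); apply Rabs_def2 in Hk'; lra. }
assert (Uuniq : forall u l m, ul u l -> ul u m -> l = m).
{ intros u l m Hl Hm. apply cond_eq. intros eps Heps.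
  destruct (FE _ (FI _ _ (Hl (eps/2) ltac:(lra)) (Hm (eps/2) ltac:(lra)))) as (k & H1 & H2).
  apply Rabs_def2 in H1. apply Rabs_def2 in H2. apply Rabs_def1; lra. }
set (L := fun u => epsilon (inhabits 0) (ul u)).
assert (HL : forall u, bounded_seq u -> ul u (L u)).
{ intros u Hu. apply epsilon_spec. now apply Uex. }
exists L. split.
- intros a b u v Hu Hv. apply (Uuniq (fun k => a * u k + b * v k)).
  + apply HL. destruct Hu as [M HM], Hv as [M' HM'].
    exists (Rabs a * M + Rabs b * M'). intros k.
    eapply Rle_trans; [apply Rabs_triang|]. rewrite !Rabs_mult.
    assert (Ha := Rabs_pos a). assert (Hb := Rabs_pos b).
    apply Rplus_le_compat; apply Rmult_le_compat_l; auto.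
  + apply Ulin; now apply HL.
- intros u c d N Hu Hc. apply (Ubd u _ c d N); [now apply HL | assumption].
Qed.

(** * Bounded operators on normed subspaces *)

Lemma vadd_swap {V : VSpace} (x y z w : V) :
  vadd (vadd x y) (vadd z w) = vadd (vadd x z) (vadd y w).
Proof.
rewrite <- !vaddA. f_equal. rewrite !vaddA. f_equal. apply vaddC.
Qed.

Lemma vadd_cancel {V : VSpace} (x y z : V) : vadd x z = vadd y z -> x = y.
Proof.
intros H. apply (f_equal (fun t => vadd t (vopp z))) in H.
now rewrite <- !vaddA, !vaddN, !vadd0 in H.
Qed.

Lemma vscal0 {V : VSpace} (x : V) : vscal 0 x = vzero.
Proof.
apply (vadd_cancel _ _ (vscal 0 x)). rewrite <- vscalDl, vaddC, vadd0. f_equal. ring.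
Qed.

Lemma vopp_scal {V : VSpace} (x : V) : vopp x = vscal (-1) x.
Proof.
apply (vadd_cancel _ _ x). rewrite vaddC, vaddN.
rewrite <- (vscal1 _ x) at 2. rewrite <- vscalDl, <- (vscal0 x). f_equal. ring.
Qed.

Lemma vsub_lin {V : VSpace} (x y : V) : vsub x y = vadd (vscal 1 x) (vscal (-1) y).
Proof. unfold vsub. now rewrite vopp_scal, vscal1. Qed.

Lemma vsub_diag {V : VSpace} (x : V) : vsub x x = vzero.
Proof. apply vaddN. Qed.

Lemma vsub_eq0 {V : VSpace} (x y : V) : vsub x y = vzero -> x = y.
Proof. intros H. apply (vadd_cancel _ _ (vopp y)). now rewrite vaddN. Qed.

Lemma vadd_vsub {V : VSpace} (x y : V) : vadd (vsub x y) y = x.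
Proof. unfold vsub. now rewrite <- vaddA, (vaddC _ _ y), vaddN, vadd0. Qed.

Lemma vsub_chain {V : VSpace} (x y z : V) : vsub x z = vadd (vsub x y) (vsub y z).
Proof.
unfold vsub at 3. rewrite vaddA, vadd_vsub. reflexivity.
Qed.

Lemma vsub_sym {V : VSpace} (x y : V) : vsub y x = vscal (-1) (vsub x y).
Proof.
unfold vsub. rewrite !vopp_scal, vscalDr, vscalA, vaddC.
replace (-1 * -1) with 1 by ring. now rewrite vscal1.
Qed.

Lemma vsub_lincomb {V : VSpace} a b (x y x' y' : V) :
  vsub (vadd (vscal a x) (vscal b y)) (vadd (vscal a x') (vscal b y')) =
  vadd (vscal a (vsub x x')) (vscal b (vsub y y')).
Proof.
unfold vsub. rewrite !vopp_scal, !vscalDr, !vscalA, vadd_swap.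
now rewrite (Rmult_comm (-1) a), (Rmult_comm (-1) b).
Qed.

(** The part of [Banach_in] that the estimates use; completeness enters only through the target
    space of an extension by density. *)
Definition normed {V : VSpace} (P : V -> Prop) (n : V -> R) : Prop :=
  subspace P /\ is_norm_on P n.

Definition linear_on {V W : VSpace} (P : V -> Prop) (T : V -> W) : Prop :=
  forall a b x y, P x -> P y ->
    T (vadd (vscal a x) (vscal b y)) = vadd (vscal a (T x)) (vscal b (T y)).

(** The sign of [K] is recorded because the inequality alone does not give it on a trivial [P], and
    the estimates multiply by [K]. *)
Definition bounded_op {V W : VSpace} (P : V -> Prop) (n : V -> R)
  (Q : W -> Prop) (m : W -> R) (T : V -> W) (K : R) : Prop :=
  (forall x, P x -> Q (T x)) /\ linear_on P T /\ 0 <= K /\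
  forall x, P x -> m (T x) <= K * n x.

Definition dense_in {V : VSpace} (D P : V -> Prop) (n : V -> R) : Prop :=
  (forall x, D x -> P x) /\
  forall x, P x -> forall eps, eps > 0 -> exists y, D y /\ n (vsub x y) < eps.

Lemma subspace_lin {V : VSpace} (P : V -> Prop) a b x y :
  subspace P -> P x -> P y -> P (vadd (vscal a x) (vscal b y)).
Proof. intros (_ & Ha & Hs) Hx Hy. auto. Qed.

Lemma subspace_sub {V : VSpace} (P : V -> Prop) x y :
  subspace P -> P x -> P y -> P (vsub x y).
Proof. intros HP Hx Hy. rewrite vsub_lin. now apply subspace_lin. Qed.

Lemma linear_sub {V W : VSpace} (P : V -> Prop) (T : V -> W) x y :
  linear_on P T -> P x -> P y -> T (vsub x y) = vsub (T x) (T y).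
Proof. intros HT Hx Hy. rewrite !vsub_lin. now apply HT. Qed.

Section Norm.
Context {V : VSpace} {P : V -> Prop} {n : V -> R} (HN : normed P n).

Lemma norm_lincomb a b x y : P x -> P y ->
  n (vadd (vscal a x) (vscal b y)) <= Rabs a * n x + Rabs b * n y.
Proof.
destruct HN as [(H0 & Ha & Hs) (Hp & Hz & Hsc & Ht)]. intros Hx Hy.
rewrite <- !Hsc by assumption. apply Ht; auto.
Qed.

Lemma norm_zero : n vzero = 0.
Proof.
destruct HN as [(H0 & _) (_ & _ & Hsc & _)].
rewrite <- (vscal0 vzero), Hsc, Rabs_R0 by assumption. ring.
Qed.

Lemma norm_sub_sym x y : P x -> P y -> n (vsub x y) = n (vsub y x).
Proof.
destruct HN as [HP (Hp & Hz & Hsc & Ht)]. intros Hx Hy.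
rewrite (vsub_sym y x), Hsc by now apply subspace_sub.
rewrite Rabs_left by lra. ring.
Qed.

Lemma norm_sub_triangle x y z : P x -> P y -> P z ->
  n (vsub x z) <= n (vsub x y) + n (vsub y z).
Proof.
destruct HN as [HP (Hp & Hz & Hsc & Ht)]. intros Hx Hy Hzz.
rewrite (vsub_chain x y z). apply Ht; now apply subspace_sub.
Qed.

Lemma norm_le_add_sub x y : P x -> P y -> n x <= n y + n (vsub x y).
Proof.
destruct HN as [HP (Hp & Hz & Hsc & Ht)]. intros Hx Hy.
rewrite <- (vadd_vsub x y) at 1. rewrite Rplus_comm.
apply Ht; [now apply subspace_sub | assumption].
Qed.

Lemma norm_eq_zero_of_small x : P x -> (forall eps, eps > 0 -> n x <= eps) -> x = vzero.
Proof.
destruct HN as [HP (Hp & Hz & Hsc & Ht)]. intros Hx He.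
apply Hz; [assumption|]. apply Rle_antisym; [|now apply Hp].
apply le_epsilon. intros eps Heps. rewrite Rplus_0_l. now apply He.
Qed.
End Norm.

(** * Extension of bounded operators by density *)

Section Extension.
Context {V W : VSpace} {P D : V -> Prop} {n : V -> R} {Q : W -> Prop} {m : W -> R}.
Context (HP : normed P n) (HQ : normed Q m) (HD : subspace D) (HDP : dense_in D P n).

Lemma bounded_op_eq_of_dense (T1 T2 : V -> W) K1 K2 :
  bounded_op P n Q m T1 K1 -> bounded_op P n Q m T2 K2 ->
  (forall x, D x -> T1 x = T2 x) -> forall x, P x -> T1 x = T2 x.
Proof.
intros (M1 & L1 & HK1 & B1) (M2 & L2 & HK2 & B2) He x Hx.
apply vsub_eq0, (norm_eq_zero_of_small HQ).
{ apply subspace_sub; [apply HQ | auto | auto]. }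
intros eps Heps.
(* For [y] in [D] the difference is T1 (x - y) + T2 (y - x), of norm at most (K1 + K2) |x - y|. The
   added 1, here and in later divisors, keeps them positive when the constants vanish. *)
destruct (proj2 HDP x Hx (eps / (K1 + K2 + 1))) as (y & Hy & Hxy).
{ apply Rdiv_lt_0_compat; lra. }
assert (HyP : P y) by now apply HDP.
eapply Rle_trans; [apply (norm_sub_triangle HQ _ (T1 y)); auto|].
rewrite (He y Hy) at 2. rewrite <- (linear_sub P T1), <- (linear_sub P T2) by auto.
assert (HPs := proj1 HP).
assert (E1 := B1 (vsub x y) ltac:(now apply subspace_sub)).
assert (E2 := B2 (vsub y x) ltac:(now apply subspace_sub)).
rewrite (norm_sub_sym HP y x) in E2 by assumption.
assert (E3 : 0 <= n (vsub x y)) by (apply HP; now apply subspace_sub).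
apply Rle_trans with ((K1 + K2 + 1) * (eps / (K1 + K2 + 1))).
- apply Rle_trans with ((K1 + K2 + 1) * n (vsub x y)); [lra|].
  apply Rmult_le_compat_l; lra.
- apply Req_le. field. lra.
Qed.

Context (T : V -> W) (K : R) (HT : bounded_op D n Q m T K) (HC : complete_in Q m).

(* The extension is the map whose graph is the closure of the graph of T. *)
Definition graph_closure (x : V) (l : W) : Prop :=
  Q l /\ forall eps, eps > 0 ->
    exists y, D y /\ n (vsub y x) < eps /\ m (vsub (T y) l) < eps.

(** The bound of [T] survives the closure with the same constant. At [x = vzero] it also makes the
    closure single valued. *)
Lemma graph_closure_norm x l : P x -> graph_closure x l -> m l <= K * n x.
Proof.
destruct HT as (MT & LT & HK & BT). intros Hx [Hl Hg].
apply le_epsilon. intros eps Heps.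
destruct (Hg (eps / (K + 1))) as (y & Hy & H1 & H2).
{ apply Rdiv_lt_0_compat; lra. }
assert (HyP : P y) by now apply HDP.
assert (E1 := norm_le_add_sub HQ l (T y) Hl (MT y Hy)).
rewrite (norm_sub_sym HQ l) in E1 by auto.
assert (E2 := norm_le_add_sub HP y x HyP Hx).
assert (E3 := BT y Hy).
assert (E4 : K * n y <= K * (n x + eps / (K + 1))) by (apply Rmult_le_compat_l; lra).
assert (E5 : K * (eps / (K + 1)) + eps / (K + 1) = eps) by (field; lra).
lra.
Qed.

Lemma graph_closure_lin a b x x' l l' : P x -> P x' ->
  graph_closure x l -> graph_closure x' l' ->
  graph_closure (vadd (vscal a x) (vscal b x')) (vadd (vscal a l) (vscal b l')).
Proof.
destruct HT as (MT & LT & HK & BT). intros Hx Hx' [Hl Hg] [Hl' Hg'].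
split; [apply subspace_lin; [apply HQ | auto | auto]|].
intros eps Heps.
assert (Ha := Rabs_pos a). assert (Hb := Rabs_pos b).
set (d := eps / (Rabs a + Rabs b + 1)).
assert (Hd : d > 0) by (apply Rdiv_lt_0_compat; lra).
assert (Ed : eps = Rabs a * d + Rabs b * d + d) by (unfold d; field; lra).
assert (Hcomb : forall s t, s < d -> t < d -> Rabs a * s + Rabs b * t < eps).
{ intros s t Hs Ht.
  assert (Rabs a * s <= Rabs a * d) by (apply Rmult_le_compat_l; lra).
  assert (Rabs b * t <= Rabs b * d) by (apply Rmult_le_compat_l; lra). lra. }
destruct (Hg d Hd) as (y & Hy & H1 & H2). destruct (Hg' d Hd) as (y' & Hy' & H1' & H2').
exists (vadd (vscal a y) (vscal b y')).
assert (HPs := proj1 HP). assert (HQs := proj1 HQ). destruct HDP as [HDP1 _].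
split; [now apply subspace_lin|]. rewrite LT by assumption. rewrite !vsub_lincomb. split.
- eapply Rle_lt_trans; [apply (norm_lincomb HP); apply subspace_sub; auto|]. auto.
- eapply Rle_lt_trans; [apply (norm_lincomb HQ); apply subspace_sub; auto|]. auto.
Qed.

(** By linearity of the closure, [l - l'] lies over [vzero], where the norm bound forces it to
    vanish. *)
Lemma graph_closure_unique x l l' : P x -> graph_closure x l -> graph_closure x l' -> l = l'.
Proof.
intros Hx Hl Hl'. apply vsub_eq0.
assert (Hd : graph_closure vzero (vsub l l')).
{ rewrite <- (vsub_diag x), !vsub_lin. now apply graph_closure_lin. }
apply HQ; [apply Hd|]. apply Rle_antisym; [|apply HQ, Hd].
eapply Rle_trans; [apply (graph_closure_norm vzero); [apply HP | exact Hd]|].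
rewrite (norm_zero HP). lra.
Qed.

Lemma graph_closure_ex x : P x -> exists l, graph_closure x l.
Proof.
destruct HT as (MT & LT & HK & BT). intros Hx.
assert (Hpos : forall k, 0 < / INR (S k)) by (intros k; apply Rinv_0_lt_compat, lt_0_INR; lia).
assert (Hsmall : forall eps, eps > 0 -> exists N, forall k, (N <= k)%nat -> / INR (S k) < eps).
{ intros eps Heps. destruct (archimed_cor1 eps Heps) as (N & HN & HN0).
  exists N. intros k Hk. eapply Rle_lt_trans; [|exact HN].
  apply Rinv_le_contravar; [now apply lt_0_INR | apply le_INR; lia]. }
assert (Hy : forall k, exists y, D y /\ n (vsub x y) < / INR (S k)).
{ intros k. apply HDP; [assumption | apply Hpos]. }
destruct (choice _ Hy) as [y Hyk]. clear Hy.
assert (HyP : forall k, P (y k)) by (intros k; apply HDP, Hyk).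
destruct (HC (fun k => T (y k))) as (l & Hl & Hlim).
{ split; [intros k; apply MT, Hyk|]. intros eps Heps.
  (* Two approximants of [x] are within twice this radius of each other, so their images differ by
     at most 2K eps / (2K + 1) < eps. *)
  destruct (Hsmall (eps / (2 * K + 1))) as [N HN]; [apply Rdiv_lt_0_compat; lra|].
  exists N. intros p q Hp Hq. rewrite <- (linear_sub D T) by (auto; apply Hyk).
  eapply Rle_lt_trans; [apply BT, subspace_sub; [assumption | apply Hyk | apply Hyk]|].
  assert (E := norm_sub_triangle HP (y p) x (y q) (HyP p) Hx (HyP q)).
  rewrite (norm_sub_sym HP (y p) x) in E by auto.
  assert (Ep := proj2 (Hyk p)). assert (Eq := proj2 (Hyk q)).
  specialize (HN p Hp) as Hp'. specialize (HN q Hq) as Hq'.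
  assert (K * n (vsub (y p) (y q)) <= K * (2 * (eps / (2 * K + 1)))) by
    (apply Rmult_le_compat_l; lra).
  assert (K * (2 * (eps / (2 * K + 1))) + eps / (2 * K + 1) = eps) by (field; lra).
  assert (0 < eps / (2 * K + 1)) by (apply Rdiv_lt_0_compat; lra).
  lra. }
exists l. split; [assumption|]. intros eps Heps.
destruct (Hsmall eps Heps) as [N HN]. destruct (Hlim eps Heps) as [M HM].
exists (y (N + M)%nat). split; [apply Hyk|]. split; [|apply HM; lia].
rewrite (norm_sub_sym HP) by auto.
eapply Rlt_trans; [apply Hyk | apply HN; lia].
Qed.

Lemma bounded_op_extension : exists T',
  bounded_op P n Q m T' K /\ forall x, D x -> T' x = T x.
Proof.
set (T' := fun x => epsilon (inhabits (vzero : W)) (graph_closure x)).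
assert (HT' : forall x, P x -> graph_closure x (T' x)).
{ intros x Hx. apply epsilon_spec. now apply graph_closure_ex. }
assert (HPs := proj1 HP).
exists T'. split; [split; [|split; [|split]]|].
- intros x Hx. now apply HT'.
- intros a b x y Hx Hy. apply (graph_closure_unique (vadd (vscal a x) (vscal b y))).
  + now apply subspace_lin.
  + apply HT'. now apply subspace_lin.
  + now apply graph_closure_lin; try apply HT'.
- apply HT.
- intros x Hx. apply graph_closure_norm; auto.
- intros x Hx. assert (HxP : P x) by now apply HDP.
  apply (graph_closure_unique x); [assumption | now apply HT'|].
  (* A point of [D] approximates itself, so (x, T x) lies in the closure of the graph. *)
  split; [now apply HT|]. intros eps Heps. exists x. split; [assumption|].
  rewrite !vsub_diag, (norm_zero HP), (norm_zero HQ). lra.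
Qed.
End Extension.

(** * Dual norms *)

(** Turns functionals into operators, so that density arguments for operators also give uniqueness
    of continuous extensions of functionals. *)
Definition realVS : VSpace.
Proof.
refine {| vcar := R; vzero := 0; vadd := Rplus; vopp := Ropp; vscal := Rmult |};
intros; simpl; ring.
Defined.

Lemma realVS_normed : @normed realVS (fun _ => True) Rabs.
Proof.
split; [now repeat split|]. split; [|split; [|split]].
- intros x _. apply Rabs_pos.
- intros x _ H. destruct (Req_dec x 0) as [E | E]; [exact E | now apply Rabs_no_R0 in E].
- intros a x _. apply Rabs_mult.
- intros x y _ _. apply Rabs_triang.
Qed.

Lemma in_dual_bounded_op {V : VSpace} (P : V -> Prop) n h :
  normed P n -> in_dual P n h -> exists K, @bounded_op V realVS P n (fun _ => True) Rabs h K.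
Proof.
intros HP [Hl [C HC]]. exists (Rabs C). split; [now auto|]. split; [exact Hl|].
split; [apply Rabs_pos|]. intros x Hx. eapply Rle_trans; [now apply HC|].
apply Rmult_le_compat_r; [now apply HP | apply Rle_abs].
Qed.

Lemma Rsup_ub (E : R -> Prop) r : bound E -> E r -> r <= Rsup E.
Proof.
intros Hb Hr. unfold Rsup. destruct excluded_middle_informative as [h | h].
- destruct completeness as [l [Hu Hl]]. simpl. now apply Hu.
- exfalso. apply h. split; [assumption | now exists r].
Qed.

(** The assumption [0 <= M] absorbs the default value 0 of [Rsup]. *)
Lemma Rsup_le (E : R -> Prop) M : 0 <= M -> (forall r, E r -> r <= M) -> Rsup E <= M.
Proof.
intros HM Hr. unfold Rsup. destruct excluded_middle_informative as [h | h].
- destruct completeness as [l [Hu Hl]]. simpl. now apply Hl.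
- assumption.
Qed.

Section DualNorm.
Context {V : VSpace} {P : V -> Prop} {n : V -> R} (HN : normed P n).

Lemma dual_norm_le g C : 0 <= C -> (forall x, P x -> Rabs (g x) <= C * n x) ->
  dual_norm P n g <= C.
Proof.
intros HC Hg. apply Rsup_le; [assumption|]. intros r (x & Hx & Hx1 & ->).
eapply Rle_trans; [now apply Hg|].
rewrite <- (Rmult_1_r C) at 2. now apply Rmult_le_compat_l.
Qed.

Lemma in_dual_bound g : in_dual P n g ->
  exists C, 0 <= C /\ forall x, P x -> Rabs (g x) <= C * n x.
Proof.
intros Hg. destruct (in_dual_bounded_op P n g HN Hg) as (K & _ & _ & HK & HB).
now exists K.
Qed.

Lemma dual_norm_unit_ball g x : in_dual P n g -> P x -> n x <= 1 -> Rabs (g x) <= dual_norm P n g.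
Proof.
intros Hg Hx Hx1. destruct (in_dual_bound g Hg) as (C & HC & HB).
apply Rsup_ub; [|now exists x].
exists C. intros r (y & Hy & Hy1 & ->). eapply Rle_trans; [now apply HB|].
rewrite <- (Rmult_1_r C) at 2. now apply Rmult_le_compat_l.
Qed.

Lemma dual_norm_pos g : in_dual P n g -> 0 <= dual_norm P n g.
Proof.
intros Hg. eapply Rle_trans; [apply Rabs_pos|].
apply (dual_norm_unit_ball g vzero Hg); [apply HN|]. rewrite (norm_zero HN). lra.
Qed.

Lemma lin_on_scal g a x : lin_on P g -> P x -> g (vscal a x) = a * g x.
Proof.
intros Hg Hx. rewrite <- (vadd0 _ (vscal a x)), <- (vscal0 x), Hg by assumption. ring.
Qed.

Lemma lin_on_zero g : lin_on P g -> g vzero = 0.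
Proof.
intros Hg. rewrite <- (vscal0 vzero), (lin_on_scal g) by (auto; apply HN). ring.
Qed.

Lemma lin_on_sub g x y : lin_on P g -> P x -> P y -> g (vsub x y) = g x - g y.
Proof. intros Hg Hx Hy. rewrite vsub_lin, Hg by assumption. ring. Qed.

Lemma dual_norm_bound g x : in_dual P n g -> P x -> Rabs (g x) <= dual_norm P n g * n x.
Proof.
intros Hg Hx. pose proof HN as [(H0 & Ha & Hs) (Hp & Hz & Hsc & Ht)].
destruct (Req_dec (n x) 0) as [E | E].
- rewrite (Hz x Hx E), (lin_on_zero g (proj1 Hg)), Rabs_R0, (norm_zero HN). lra.
- assert (0 < n x) by (specialize (Hp x Hx); lra).
  assert (Hi : 0 < / n x) by now apply Rinv_0_lt_compat.
  assert (B := dual_norm_unit_ball g (vscal (/ n x) x) Hg (Hs _ _ Hx)).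
  rewrite Hsc, (lin_on_scal g) in B by (assumption || apply Hg).
  rewrite Rabs_mult, (Rabs_pos_eq (/ n x)) in B by lra.
  rewrite Rinv_l in B by assumption. specialize (B (Rle_refl 1)).
  apply (Rmult_le_compat_r (n x)) in B; [|lra].
  replace (/ n x * Rabs (g x) * n x) with (Rabs (g x)) in B by (field; assumption). exact B.
Qed.

Lemma in_dual_lincomb a b g h : in_dual P n g -> in_dual P n h ->
  in_dual P n (fun x => a * g x + b * h x).
Proof.
intros Hg Hh. destruct (in_dual_bound g Hg) as (C & HC & HB).
destruct (in_dual_bound h Hh) as (C' & HC' & HB'). split.
- intros s t x y Hx Hy. rewrite (proj1 Hg), (proj1 Hh) by assumption. ring.
- exists (Rabs a * C + Rabs b * C'). intros x Hx.
  eapply Rle_trans; [apply Rabs_triang|]. rewrite !Rabs_mult.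
  specialize (HB x Hx). specialize (HB' x Hx).
  assert (Rabs a * Rabs (g x) <= Rabs a * (C * n x)) by (apply Rmult_le_compat_l; [apply Rabs_pos | lra]).
  assert (Rabs b * Rabs (h x) <= Rabs b * (C' * n x)) by (apply Rmult_le_compat_l; [apply Rabs_pos | lra]).
  lra.
Qed.

Lemma in_dual_ext g h : (forall x, P x -> g x = h x) -> in_dual P n g -> in_dual P n h.
Proof.
intros E [Hl [C HC]]. split.
- intros a b x y Hx Hy. rewrite <- !E; auto. apply (subspace_lin P); auto. apply HN.
- exists C. intros x Hx. rewrite <- E by assumption. auto.
Qed.

Lemma in_dual_rsum (h : nat -> V -> R) (c : nat -> R) k : (forall i, in_dual P n (h i)) ->
  in_dual P n (fun x => rsum (fun i => c i * h i x) k).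
Proof.
intros Hh. induction k as [|k IH]; simpl.
- split; [intros a b x y _ _; ring|]. exists 0. intros x _. rewrite Rabs_R0. lra.
- apply (in_dual_ext (fun x => 1 * rsum (fun i => c i * h i x) k + c k * h k x)).
  + intros x _. ring.
  + now apply in_dual_lincomb.
Qed.
End DualNorm.

(** Comparing absolute values lets the lemma absorb a change of sign as well. *)
Lemma dual_norm_ext {V : VSpace} (P : V -> Prop) n (g h : V -> R) :
  (forall x, P x -> Rabs (g x) = Rabs (h x)) -> dual_norm P n g = dual_norm P n h.
Proof.
intros H. unfold dual_norm. f_equal. apply functional_extensionality. intros r.
apply propositional_extensionality.
split; intros (x & Hx & H1 & ->); exists x; rewrite H by assumption; auto.
Qed.

Section Composition.
Context {V W : VSpace} {P : V -> Prop} {n : V -> R} {Q : W -> Prop} {m : W -> R}.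
Context (HP : normed P n) (HQ : normed Q m).
Context {T : V -> W} {K : R} (HT : bounded_op P n Q m T K).

Lemma comp_bound (h : W -> R) x : in_dual Q m h -> P x ->
  Rabs (h (T x)) <= K * dual_norm Q m h * n x.
Proof.
destruct HT as (MT & LT & HK & BT). intros Hh Hx.
eapply Rle_trans; [apply (dual_norm_bound HQ); auto|].
rewrite (Rmult_comm K), Rmult_assoc. apply Rmult_le_compat_l; [now apply dual_norm_pos | auto].
Qed.

Lemma in_dual_comp (h : W -> R) : in_dual Q m h -> in_dual P n (fun x => h (T x)).
Proof.
intros Hh. split.
- destruct HT as (MT & LT & HK & BT).
  intros a b x y Hx Hy. rewrite LT by assumption. apply Hh; auto.
- exists (K * dual_norm Q m h). intros x Hx. now apply comp_bound.
Qed.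

Lemma dual_norm_comp (h : W -> R) : in_dual Q m h ->
  dual_norm P n (fun x => h (T x)) <= K * dual_norm Q m h.
Proof.
intros Hh. apply dual_norm_le.
- apply Rmult_le_pos; [apply HT | now apply dual_norm_pos].
- intros x Hx. now apply comp_bound.
Qed.
End Composition.

Lemma vsum_mem {V : VSpace} (P : V -> Prop) (u : nat -> V) k :
  subspace P -> (forall i, P (u i)) -> P (vsum u k).
Proof. intros HP Hu. induction k; simpl; [apply HP | now apply HP]. Qed.

Lemma lin_on_vsum {V : VSpace} (P : V -> Prop) (h : V -> R) (c : nat -> R) (u : nat -> V) k :
  subspace P -> (forall i, P (u i)) -> lin_on P h ->
  h (vsum (fun i => vscal (c i) (u i)) k) = rsum (fun i => h (u i) * c i) k.
Proof.
intros HP Hu Hh. assert (Hs : forall i, P (vscal (c i) (u i))) by (intros i; now apply HP).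
induction k as [|k IH]; simpl.
- rewrite <- (vsub_diag vzero), (@lin_on_sub V P h) by (assumption || apply HP). ring.
- rewrite <- (vscal1 _ (vsum _ k)), Hh by (auto; now apply vsum_mem). rewrite IH. ring.
Qed.

Lemma linear_vsum {V W : VSpace} (P : V -> Prop) (T : V -> W) (c : nat -> R) (u : nat -> V) k :
  subspace P -> (forall i, P (u i)) -> linear_on P T ->
  T (vsum (fun i => vscal (c i) (u i)) k) = vsum (fun i => vscal (c i) (T (u i))) k.
Proof.
intros HP Hu HT. assert (Hs : forall i, P (vscal (c i) (u i))) by (intros i; now apply HP).
induction k as [|k IH]; simpl.
- rewrite <- (vsub_diag vzero), (linear_sub P) by (auto; apply HP). apply vsub_diag.
- rewrite <- (vscal1 _ (vsum _ k)), HT by (auto; now apply vsum_mem). now rewrite IH, vscal1.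
Qed.

(** * Sequence spaces and shrinking bases *)

Lemma trunc_S m c :
  trunc (S m) c = fun i => trunc m c i + c m * ecan m i.
Proof.
apply functional_extensionality. intros i. unfold trunc, ecan.
destruct (Nat.ltb_spec i (S m)), (Nat.ltb_spec i m), (Nat.eqb_spec m i); subst; try lia; ring.
Qed.

Lemma trunc_vsum m c : trunc m c = @vsum seqVS (fun i => @vscal seqVS (c i) (ecan i)) m.
Proof.
induction m as [|m IH]; simpl.
- apply functional_extensionality. intros i. reflexivity.
- now rewrite trunc_S, IH.
Qed.

(** Under the identification of Theta^* with sequences, partial sums in the coordinate functionals
    are therefore truncations. *)
Lemma rsum_ecan d j m : rsum (fun i => d i * ecan j i) m = trunc m d j.
Proof.
induction m as [|m IH]; simpl; [reflexivity|].
rewrite trunc_S, IH. unfold ecan. now rewrite Nat.eqb_sym.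
Qed.

Lemma Un_cv_of_norm (n : nat -> R) (u : nat -> R) l K : 0 <= K ->
  (forall m, Rabs (u m - l) <= K * n m) -> (forall m, 0 <= n m) ->
  (forall eps, eps > 0 -> exists N, forall p, (N <= p)%nat -> n p < eps) -> Un_cv u l.
Proof.
intros HK Hu Hp Hn eps Heps.
destruct (Hn (eps / (K + 1))) as [N HN]; [apply Rdiv_lt_0_compat; lra|].
exists N. intros m Hm. unfold Rdist. eapply Rle_lt_trans; [apply Hu|].
apply Rle_lt_trans with (K * (eps / (K + 1))).
- apply Rmult_le_compat_l; [assumption | left; now apply HN].
- assert (0 < eps / (K + 1)) by (apply Rdiv_lt_0_compat; lra).
  assert (K * (eps / (K + 1)) + eps / (K + 1) = eps) by (field; lra). lra.
Qed.

(** The classical notion of a shrinking basis: the biorthogonal functionals form a basis of the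
    dual. Stated with functionals rather than with [dseq_norm], so that it can be composed with
    operators. *)
Definition shrinking (Th : (nat -> R) -> Prop) (tn : (nat -> R) -> R) : Prop :=
  forall G, @in_dual seqVS Th tn G ->
    Un_cv (fun m => @dual_norm seqVS Th tn
             (fun c => G c - rsum (fun i => G (ecan i) * c i) m)) 0.

Section CB.
Context {Th : (nat -> R) -> Prop} {tn : (nat -> R) -> R} (HCB : CB_space Th tn).

Lemma CB_normed : @normed seqVS Th tn.
Proof. destruct HCB as (((Hs & Hn & _) & _) & _). now split. Qed.

Lemma CB_trunc_mem m c : Th (trunc m c).
Proof.
rewrite trunc_vsum. apply (@vsum_mem seqVS); [apply CB_normed|].
intros i. apply (proj1 CB_normed), HCB.
Qed.

Lemma CB_coord i : @in_dual seqVS Th tn (fun c => c i).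
Proof.
destruct HCB as ((_ & HB) & _). split; [intros a b x y _ _; reflexivity | exact (HB i)].
Qed.

Lemma CB_dual_trunc G m c : @in_dual seqVS Th tn G ->
  G (trunc m c) = rsum (fun i => G (ecan i) * c i) m.
Proof.
intros HG. rewrite trunc_vsum. apply (@lin_on_vsum seqVS Th); [apply CB_normed | apply HCB | apply HG].
Qed.

Lemma CB_dual_expansion G c : @in_dual seqVS Th tn G -> Th c ->
  Un_cv (fun m => rsum (fun i => G (ecan i) * c i) m) (G c).
Proof.
intros HG Hc.
apply (Un_cv_of_norm (fun m => tn (@vsub seqVS (trunc m c) c)) _ _ (@dual_norm seqVS Th tn G)).
- apply (dual_norm_pos CB_normed _ HG).
- intros m. rewrite <- CB_dual_trunc by assumption.
  rewrite <- (@lin_on_sub seqVS Th G) by (apply HG || apply CB_trunc_mem || assumption).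
  apply (dual_norm_bound CB_normed); [assumption|].
  apply (@subspace_sub seqVS); [apply CB_normed | apply CB_trunc_mem | assumption].
- intros m. apply CB_normed.
  apply (@subspace_sub seqVS); [apply CB_normed | apply CB_trunc_mem | assumption].
- now apply HCB.
Qed.

(** The finite sequences are dense in a CB-space; this makes the identification of Theta^* with
    sequences injective, up to values outside [Th]. *)
Lemma CB_dual_ext G H : @in_dual seqVS Th tn G -> @in_dual seqVS Th tn H ->
  (forall i, G (ecan i) = H (ecan i)) -> forall c, Th c -> G c = H c.
Proof.
intros HG HH E c Hc. eapply UL_sequence; [now apply CB_dual_expansion|].
replace (fun m => _) with (fun m => rsum (fun i => H (ecan i) * c i) m).
- now apply CB_dual_expansion.
- apply functional_extensionality. intros m. f_equal.
  apply functional_extensionality. intros i. now rewrite E.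
Qed.

(** [dseq_norm] takes a supremum over all representing functionals, but these coincide on [Th], so
    any one of them computes it. *)
Lemma dseq_norm_eq G d : @in_dual seqVS Th tn G -> (forall i, d i = G (ecan i)) ->
  dseq_norm Th tn d = @dual_norm seqVS Th tn G.
Proof.
intros HG Hd. unfold dseq_norm, dual_norm. f_equal.
apply functional_extensionality. intros r. apply propositional_extensionality. split.
- intros (H & HH & HdH & c & Hc & Hc1 & ->). exists c. repeat split; auto.
  f_equal. apply CB_dual_ext; auto. intros i. now rewrite <- Hd, <- HdH.
- intros (c & Hc & Hc1 & ->). exists G. repeat split; try apply HG; auto. now exists c.
Qed.

Lemma in_dual_tail G m : @in_dual seqVS Th tn G ->
  @in_dual seqVS Th tn (fun c => G c - rsum (fun i => G (ecan i) * c i) m).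
Proof.
intros HG.
apply (in_dual_ext CB_normed (fun c => 1 * G c + (-1) * rsum (fun i => G (ecan i) * c i) m)).
- intros c _. ring.
- apply (in_dual_lincomb CB_normed); [assumption|].
  apply (in_dual_rsum CB_normed (fun i c => c i)). apply CB_coord.
Qed.

Lemma CB_dual_shrinking : CB_space (dseq_mem Th tn) (dseq_norm Th tn) -> shrinking Th tn.
Proof.
intros (_ & _ & Hcv) G HG.
set (d := fun i => G (ecan i)).
assert (Hd : dseq_mem Th tn d) by now exists G.
assert (E : forall m, dseq_norm Th tn (@vsub seqVS (trunc m d) d) =
  @dual_norm seqVS Th tn (fun c => G c - rsum (fun i => G (ecan i) * c i) m)).
{ intros m. set (H := fun c => G c - rsum (fun i => G (ecan i) * c i) m).
  assert (HH : @in_dual seqVS Th tn H) by now apply in_dual_tail.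
  (* The tail [H] has coordinates [d - trunc m d], so [- H] represents the required difference; it
     is written as a linear combination to stay visibly in the dual. *)
  rewrite (dseq_norm_eq (fun c => 0 * H c + (-1) * H c)).
  - apply dual_norm_ext. intros c _. rewrite <- Rabs_Ropp. f_equal. ring.
  - now apply (in_dual_lincomb CB_normed).
  - intros i. unfold H. rewrite (rsum_ecan d). unfold vsub, d. simpl. ring. }
apply (Un_cv_of_norm (fun m => dseq_norm Th tn (@vsub seqVS (trunc m d) d)) _ _ 1).
- lra.
- intros m. rewrite E, Rminus_0_r, Rabs_pos_eq; [lra|].
  now apply (dual_norm_pos CB_normed), in_dual_tail.
- intros m. rewrite E. now apply (dual_norm_pos CB_normed), in_dual_tail.
- now apply Hcv.
Qed.

(* Failure of shrinking produces bounded vectors [v k] supported on [[k, oo)] on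
   which [G] stays away from 0. A generalized limit along [v] is then an element of
   the bidual vanishing on all coordinate functionals but not on [G]; reflexivity
   would represent it by the zero sequence. *)
Lemma reflexive_shrinking lam : lamBK Th tn lam -> reflexive_seq Th tn -> shrinking Th tn.
Proof.
intros (_ & _ & Hlam) Hrefl G HG.
pose proof CB_normed as HN. pose proof HN as [Hsub (Hp & Hz & Hsc & Ht)].
apply NNPP. intros Hncv.
set (tail := fun m c => G c - rsum (fun i => G (ecan i) * c i) m) in *.
assert (Hex : exists eps, eps > 0 /\ forall N, exists m, (N <= m)%nat /\
          eps <= @dual_norm seqVS Th tn (tail m)).
{ apply NNPP. intros Hn. apply Hncv. intros eps Heps. apply NNPP. intros HnN.
  apply Hn. exists eps. split; [assumption|]. intros N. apply NNPP. intros Hm.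
  apply HnN. exists N. intros m HNm. unfold Rdist.
  rewrite Rminus_0_r, Rabs_pos_eq by now apply (dual_norm_pos HN), in_dual_tail.
  apply Rnot_le_lt. intros Hle. apply Hm. exists m. auto. }
destruct Hex as (eps & Heps & Hex).
(* Bounds c - trunc m c for [c] in the unit ball, by the [lamBK] estimate on truncations. *)
set (M := 1 + Rabs lam).
assert (Hv : forall N : nat, exists v, Th v /\ tn v <= M /\ (forall i, (i < N)%nat -> v i = 0) /\
          eps / 2 <= G v).
{ intros N. destruct (Hex N) as (m & HNm & Hm).
  (* The dual norm need not be attained on the unit ball, hence the loss of a factor 2. *)
  assert (Hc : exists c, Th c /\ tn c <= 1 /\ eps / 2 < Rabs (tail m c)).
  { apply NNPP. intros Hn.
    assert (@dual_norm seqVS Th tn (tail m) <= eps / 2); [|lra].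
    apply Rsup_le; [lra|]. intros r (c & Hc & Hc1 & ->). apply Rnot_lt_le. intros Hlt.
    apply Hn. now exists c. }
  destruct Hc as (c & Hc & Hc1 & Hlt).
  set (w := @vsub seqVS c (trunc m c)).
  assert (Hw : Th w) by (apply (@subspace_sub seqVS); auto; apply CB_trunc_mem).
  assert (HGw : G w = tail m c).
  { unfold w, tail. rewrite (@lin_on_sub seqVS Th) by (apply HG || apply CB_trunc_mem || assumption).
    now rewrite CB_dual_trunc. }
  assert (Hnw : tn w <= M).
  { unfold w. rewrite (@vsub_lin seqVS).
    eapply Rle_trans; [apply (norm_lincomb HN); [assumption | apply CB_trunc_mem]|].
    rewrite Rabs_R1, (Rabs_left (-1)) by lra.
    assert (H1 := Hlam m c Hc).
    assert (0 <= tn c) by now apply Hp.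
    assert (lam * tn c <= Rabs lam * tn c) by (apply Rmult_le_compat_r; [assumption | apply Rle_abs]).
    assert (Rabs lam * tn c <= Rabs lam * 1) by (apply Rmult_le_compat_l; [apply Rabs_pos | assumption]).
    unfold M. lra. }
  assert (Hw0 : forall i, (i < N)%nat -> w i = 0).
  { intros i Hi. unfold w, vsub, trunc. simpl. destruct (Nat.ltb_spec i m); [ring | lia]. }
  (* Replacing [w] by its opposite if necessary makes [G] positive on all blocks, so that the lower
     bound [eps / 2] passes to the generalized limit. *)
  rewrite <- HGw in Hlt. destruct (Rle_lt_dec 0 (G w)) as [Hs | Hs].
  - exists w. rewrite Rabs_pos_eq in Hlt by assumption. repeat split; auto; lra.
  - exists (@vscal seqVS (-1) w). rewrite Rabs_left in Hlt by assumption.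
    split; [now apply Hsub|]. split; [rewrite Hsc, Rabs_left by (assumption || lra); lra|].
    split.
    + intros i Hi. simpl. rewrite Hw0 by assumption. ring.
    + rewrite (lin_on_scal G) by (assumption || apply HG). lra. }
destruct (choice _ Hv) as [v Hvk]. clear Hv.
destruct generalized_limit as (L & Llin & Lbd).
assert (Hdb : forall h, @in_dual seqVS Th tn h -> forall k,
          - (M * @dual_norm seqVS Th tn h) <= h (v k) <= M * @dual_norm seqVS Th tn h).
{ intros h Hh k. destruct (Hvk k) as (H1 & H2 & _).
  assert (E := dual_norm_bound HN h (v k) Hh H1).
  assert (@dual_norm seqVS Th tn h * tn (v k) <= @dual_norm seqVS Th tn h * M)
    by (apply Rmult_le_compat_l; [now apply (dual_norm_pos HN) | assumption]).
  assert (E1 := Rle_abs (h (v k))). assert (E2 := Rle_abs (- h (v k))).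
  rewrite Rabs_Ropp in E2. lra. }
assert (Hbs : forall h, @in_dual seqVS Th tn h -> bounded_seq (fun k => h (v k))).
{ intros h Hh. eexists. intros k. apply Rabs_le. apply (Hdb h Hh). }
destruct (Hrefl (fun h => L (fun k => h (v k)))) as (c & Hc & HPhi).
- intros a b g h Hg Hh. apply Llin; now apply Hbs.
- exists M. intros h Hh. apply Rabs_le. apply (Lbd _ _ _ 0%nat); [now apply Hbs|].
  intros k _. now apply Hdb.
- assert (Hc0 : c = @vzero seqVS).
  { apply functional_extensionality. intros i.
    rewrite <- (HPhi (fun c => c i)) by apply CB_coord.
    (* [v k] vanishes at [i] as soon as [i < k], whence the cutoff [S i]. *)
    apply Rle_antisym; apply (Lbd _ 0 0 (S i)); try (apply (Hbs (fun c => c i)), CB_coord);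
      intros k Hk; destruct (Hvk k) as (_ & _ & H3 & _); rewrite H3 by lia; lra. }
  specialize (HPhi G HG). rewrite Hc0, (lin_on_zero HN G) in HPhi by apply HG.
  assert (eps / 2 <= L (fun k => G (v k))); [|lra].
  apply (Lbd _ _ (M * @dual_norm seqVS Th tn G) 0%nat); [now apply Hbs|].
  intros k _. split; [apply Hvk | now apply Hdb].
Qed.
End CB.

(** * Frames and expansions transferred along a retraction of a CB-space onto X_s *)

Section Retract.
Context {V : VSpace} {P : V -> Prop} {n : V -> R} (HP : normed P n).
Context {Th : (nat -> R) -> Prop} {tn : (nat -> R) -> R} (HCB : CB_space Th tn).
Context {C : V -> nat -> R} {U : (nat -> R) -> V} {B K : R}.
Context (HC : @bounded_op V seqVS P n Th tn C B) (HU : @bounded_op seqVS V Th tn P n U K).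
Context (HUC : forall x, P x -> U (C x) = x).
Context {f : nat -> V} (Hf : forall i, f i = U (ecan i)).

Lemma retract_expansion x : P x ->
  conv_in n (fun m => vsum (fun i => vscal (C x i) (f i)) m) x.
Proof.
pose proof HU as (MU & LU & HK & BU). intros Hx.
assert (HCx : Th (C x)) by now apply HC.
assert (HCV := proj2 (proj2 HCB) _ HCx). intros eps Heps.
destruct (HCV (eps / (K + 1))) as [N HN]; [apply Rdiv_lt_0_compat; lra|].
exists N. intros m Hm.
replace f with (fun i => U (ecan i)) by (apply functional_extensionality; now symmetry).
rewrite <- (@linear_vsum seqVS V Th U (C x) ecan) by (apply (CB_normed HCB) || apply HCB || assumption).
rewrite <- trunc_vsum. rewrite <- (HUC x) at 2 by assumption.
assert (Hs : Th (@vsub seqVS (trunc m (C x)) (C x))).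
{ apply (@subspace_sub seqVS); [apply (CB_normed HCB) | apply (CB_trunc_mem HCB) | assumption]. }
rewrite <- (@linear_sub seqVS V Th U) by (assumption || now apply (CB_trunc_mem HCB)).
eapply Rle_lt_trans; [now apply BU|].
specialize (HN m Hm).
apply Rle_lt_trans with (K * (eps / (K + 1))).
- apply Rmult_le_compat_l; [assumption | lra].
- assert (0 < eps / (K + 1)) by (apply Rdiv_lt_0_compat; lra).
  assert (K * (eps / (K + 1)) + eps / (K + 1) = eps) by (field; lra). lra.
Qed.

Lemma retract_dual h : in_dual P n h -> @in_dual seqVS Th tn (fun c => h (U c)).
Proof. intros Hh. exact (in_dual_comp HP HU h Hh). Qed.

(** The sequence h(f_i) consists of the values of h o U on the canonical vectors, so frame bounds
    for [f] become estimates for composition with [U] and [C]. *)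
Lemma retract_dseq_norm h : in_dual P n h ->
  dseq_norm Th tn (fun i => h (f i)) = @dual_norm seqVS Th tn (fun c => h (U c)).
Proof. intros Hh. apply (dseq_norm_eq HCB); [now apply retract_dual | intros i; now rewrite Hf]. Qed.

Lemma retract_dBessel : dBessel P n Th tn f.
Proof.
split.
- intros h Hh. exists (fun c => h (U c)). split; [now apply retract_dual | intros i; now rewrite Hf].
- exists K. intros h Hh. rewrite retract_dseq_norm by assumption. now apply (dual_norm_comp HP HU).
Qed.

(** The lower bound holds because h = (h o U) o C on [P], whence |h| <= B |h o U| in dual norms. *)
Lemma retract_dFrame : dFrame P n Th tn f.
Proof.
split; [exact retract_dBessel|].
assert (HB : 0 <= B) by apply HC.
assert (HB' : 0 < / (B + 1)) by (apply Rinv_0_lt_compat; lra).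
exists (/ (B + 1)). split; [assumption|]. intros h Hh. rewrite retract_dseq_norm by assumption.
assert (H1 := dual_norm_comp (CB_normed HCB) HC (fun c => h (U c)) (retract_dual h Hh)).
rewrite (dual_norm_ext P n _ h) in H1 by (intros x Hx; now rewrite HUC).
assert (H2 := dual_norm_pos (CB_normed HCB) _ (retract_dual h Hh)).
apply Rmult_le_reg_l with (B + 1); [lra|].
rewrite <- Rmult_assoc, Rinv_r by lra. lra.
Qed.

(** The reconstruction operator is the adjoint of [C]: it sends the sequence of h o U to h o U o C =
    h. *)
Lemma retract_dBanach_frame : dBanach_frame P n Th tn f.
Proof.
split; [exact retract_dFrame|].
(* A chosen functional representing [d]. It is determined only on [Th], so linearity and
   reconstruction are checked at points [C x] of [Th]. *)
set (rep := fun d => epsilon (inhabits (fun _ : nat -> R => 0))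
   (fun G => @in_dual seqVS Th tn G /\ forall i, d i = G (ecan i))).
assert (Hrep : forall d, dseq_mem Th tn d ->
   @in_dual seqVS Th tn (rep d) /\ forall i, d i = rep d (ecan i)).
{ intros d Hd. unfold rep. now apply epsilon_spec. }
assert (Huniq : forall d G, @in_dual seqVS Th tn G -> (forall i, d i = G (ecan i)) ->
   forall c, Th c -> rep d c = G c).
{ intros d G HG Hd c Hc. destruct (Hrep d) as [H1 H2]; [now exists G|].
  apply (CB_dual_ext HCB); auto. intros i. now rewrite <- H2, <- Hd. }
assert (MC : forall x, P x -> Th (C x)) by apply HC.
exists (fun d x => rep d (C x)). split; [|split; [|split]].
- intros d Hd. exact (in_dual_comp (CB_normed HCB) HC _ (proj1 (Hrep d Hd))).
- intros a b d1 d2 H1 H2 x Hx.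
  destruct (Hrep d1 H1) as [G1 E1]. destruct (Hrep d2 H2) as [G2 E2].
  apply (Huniq _ (fun c => a * rep d1 c + b * rep d2 c)); [|now intros i; rewrite E1, E2 | auto].
  now apply (in_dual_lincomb (CB_normed HCB)).
- exists B. intros d Hd. destruct (Hrep d Hd) as [G E].
  rewrite (dseq_norm_eq HCB _ d G E). now apply (dual_norm_comp (CB_normed HCB) HC).
- intros h Hh x Hx. rewrite (Huniq _ (fun c => h (U c))); [now rewrite HUC | | intros i; now rewrite Hf | auto].
  now apply retract_dual.
Qed.

Lemma retract_dual_expansion : shrinking Th tn -> forall h, in_dual P n h ->
  Un_cv (fun m => dual_norm P n (fun x => h x - rsum (fun i => h (f i) * C x i) m)) 0.
Proof.
intros Hs h Hh. set (G := fun c => h (U c)).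
assert (HG : @in_dual seqVS Th tn G) by now apply retract_dual.
assert (Hin := fun m => in_dual_tail HCB G m HG). specialize (Hs G HG).
set (tail := fun m c => G c - rsum (fun i => G (ecan i) * c i) m) in *.
assert (E : forall m, dual_norm P n (fun x => h x - rsum (fun i => h (f i) * C x i) m) =
            dual_norm P n (fun x => tail m (C x))).
{ intros m. apply dual_norm_ext. intros x Hx. unfold tail, G. rewrite HUC by assumption. do 2 f_equal.
  f_equal. apply functional_extensionality. intros i. now rewrite Hf. }
apply (Un_cv_of_norm (fun m => @dual_norm seqVS Th tn (tail m)) _ _ B); [apply HC | | |].
- intros m. rewrite E, Rminus_0_r, Rabs_pos_eq.
  + exact (dual_norm_comp (CB_normed HCB) HC _ (Hin m)).
  + apply (dual_norm_pos HP). exact (in_dual_comp (CB_normed HCB) HC _ (Hin m)).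
- intros m. exact (dual_norm_pos (CB_normed HCB) _ (Hin m)).
- intros eps Heps. destruct (Hs eps Heps) as [N HN]. exists N. intros m Hm.
  specialize (HN m Hm). unfold Rdist in HN. rewrite Rminus_0_r in HN.
  eapply Rle_lt_trans; [apply Rle_abs | exact HN].
Qed.
End Retract.

(** * F-frames *)

Section FFamilies.
Context {V : VSpace} {P : nat -> V -> Prop} {nrm : nat -> V -> R}.

Lemma FFamily_normed (s : nat) : FFamily P nrm -> normed (P s) (nrm s).
Proof. intros (HB & _). destruct (HB s) as (H1 & H2 & _). now split. Qed.

Lemma PF_subspace : FFamily P nrm -> subspace (PF P).
Proof.
intros (HB & _). split; [|split].
- intros s. apply HB.
- intros x y Hx Hy s. now apply HB.
- intros a x Hx s. now apply HB.
Qed.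

Lemma PF_dense (s : nat) : FFamily P nrm -> dense_in (PF P) (P s) (nrm s).
Proof.
intros (_ & _ & _ & _ & Hd). split; [intros x Hx; apply Hx | exact (Hd s)].
Qed.
End FFamilies.

(** All data at level [s]. Agreement of [U] with [U0] makes U(e_i) independent of [s]; the last
    clause identifies the coordinates of [C] with any choice of the extensions g_i^s, since the
    theorem quantifies over all such choices. *)
Lemma F_frame_extension {V : VSpace} (P : nat -> V -> Prop) (nrm : nat -> V -> R)
  (Th : nat -> (nat -> R) -> Prop) (tn : nat -> (nat -> R) -> R) (g : nat -> V -> R)
  (U0 : (nat -> R) -> V) (s : nat) :
  FFamily P nrm -> @FFamily seqVS Th tn -> BK_space (Th s) (tn s) ->
  pre_F_frame P nrm Th tn g ->
  (forall c, @PF seqVS Th c -> PF P (U0 c)) -> @linear_on seqVS V (@PF seqVS Th) U0 ->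
  (exists K, forall c, @PF seqVS Th c -> nrm s (U0 c) <= K * tn s c) ->
  (forall x, PF P x -> U0 (fun i => g i x) = x) ->
  exists (C : V -> nat -> R) (U : (nat -> R) -> V) (B K : R),
    @bounded_op V seqVS (P s) (nrm s) (Th s) (tn s) C B /\
    @bounded_op seqVS V (Th s) (tn s) (P s) (nrm s) U K /\
    (forall x, P s x -> U (C x) = x) /\
    (forall c, @PF seqVS Th c -> U c = U0 c) /\
    (forall i, is_ext P nrm s (g i) (fun x => C x i)) /\
    (forall gs, (forall i, is_ext P nrm s (g i) (gs i)) ->
       forall x, P s x -> C x = fun i => gs i x).
Proof.
intros HF HFT HBK (Hgd & Hgm & Hgb) MU LU [K HK] HU.
pose proof (FFamily_normed s HF) as HN.
pose proof (@FFamily_normed seqVS _ _ s HFT) as HNT.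
pose proof (PF_dense s HF) as HD.
pose proof (@PF_dense seqVS _ _ s HFT) as HDT.
assert (Hcoord : forall i, @in_dual seqVS (Th s) (tn s) (fun c => c i)).
{ intros i. split; [intros a b x y _ _; reflexivity | exact (proj2 HBK i)]. }
destruct (Hgb s) as (A & B & HA & HAB & HB).
destruct (@bounded_op_extension V seqVS (P s) (PF P) (nrm s) (Th s) (tn s) HN HNT
  (PF_subspace HF) HD (fun x i => g i x) B) as (C & HC & HCg).
{ split; [intros x Hx; now apply Hgm|]. split.
  - intros a b x y Hx Hy. apply functional_extensionality. intros i. now apply Hgd.
  - split; [lra|]. intros x Hx. now apply HB. }
{ apply HFT. }
destruct (@bounded_op_extension seqVS V (Th s) (@PF seqVS Th) (tn s) (P s) (nrm s) HNT HN
  (PF_subspace HFT) HDT U0 (Rabs K)) as (U & HU' & HUU0).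
{ split; [intros c Hc; now apply MU|]. split; [exact LU|].
  split; [apply Rabs_pos|]. intros c Hc. eapply Rle_trans; [now apply HK|].
  apply Rmult_le_compat_r; [apply HNT, Hc | apply Rle_abs]. }
{ apply HF. }
exists C, U, B, (Rabs K).
assert (Hext : forall i, is_ext P nrm s (g i) (fun x => C x i)).
{ intros i. split; [exact (in_dual_comp HNT HC _ (Hcoord i))|].
  intros x Hx. now rewrite HCg. }
split; [assumption|]. split; [assumption|]. split; [|split; [assumption|split; [assumption|]]].
- apply (bounded_op_eq_of_dense HN HN HD (fun x => U (C x)) (fun x => x) (Rabs K * B) 1).
  + destruct HC as (MC & LC & HB0 & BC). destruct HU' as (MU' & LU' & HK0 & BU').
    split; [auto|]. split; [intros a b x y Hx Hy; rewrite LC, LU'; auto|].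
    split; [now apply Rmult_le_pos|]. intros x Hx. eapply Rle_trans; [apply BU'; auto|].
    rewrite Rmult_assoc. apply Rmult_le_compat_l; auto.
  + split; [auto|]. split; [intros a b x y _ _; reflexivity|]. split; [lra|].
    intros x Hx. lra.
  + intros x Hx. rewrite HCg, HUU0 by (try apply Hgm; assumption). now apply HU.
- intros gs Hgs x Hx. apply functional_extensionality. intros i.
  destruct (in_dual_bounded_op _ _ _ HN (proj1 (Hext i))) as [K1 H1].
  destruct (in_dual_bounded_op _ _ _ HN (proj1 (Hgs i))) as [K2 H2].
  apply (@bounded_op_eq_of_dense V realVS _ _ _ _ _ HN realVS_normed HD _ _ _ _ H1 H2); [|assumption].
  intros y Hy. rewrite (proj2 (Hgs i)) by assumption. now apply (Hext i).
Qed.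

(** The lower frame bound comes from the left inverse: |x| = |U (C x)| <= K |C x|, where C x is the
    sequence of the g_i(x). *)
Lemma Banach_frame_of_retract {V : VSpace} (P : V -> Prop) n
  (Th : (nat -> R) -> Prop) tn (g : nat -> V -> R)
  (U : (nat -> R) -> V) B K :
  normed P n -> @normed seqVS Th tn -> (forall i, in_dual P n (g i)) ->
  @bounded_op V seqVS P n Th tn (fun x i => g i x) B ->
  @bounded_op seqVS V Th tn P n U K ->
  (forall x, P x -> U (fun i => g i x) = x) -> Banach_frame P n Th tn g.
Proof.
intros HN HNT Hg (MC & LC & HB & BC) (MU & LU & HK & BU) HUC.
split; [assumption|]. split; [assumption|]. split.
- assert (HK' : 0 < / (K + 1)) by (apply Rinv_0_lt_compat; lra).
  exists (/ (K + 1)), B. split; [assumption|]. intros x Hx. split; [|now apply BC].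
  assert (H1 := BU _ (MC x Hx)). rewrite HUC in H1 by assumption.
  assert (H2 : 0 <= tn (fun i => g i x)) by now apply HNT, MC.
  apply Rmult_le_reg_l with (K + 1); [lra|].
  rewrite <- Rmult_assoc, Rinv_r by lra. lra.
- exists U. split; [assumption|]. split; [exact LU|]. split; [now exists K | assumption].
Qed.

(** A continuous functional on X_F is dominated by a single norm [nrm s], so it can be applied
    termwise to the expansion of [x] in that norm. *)
Lemma exp_XFdual_of_exp_XF {V : VSpace} (P : nat -> V -> Prop) nrm g (f : nat -> V) :
  FFamily P nrm -> (forall i, PF P (f i)) -> exp_XF P nrm g f -> exp_XFdual P nrm g f.
Proof.
intros HF Hf Hexp h (Hl & s & K & HK) x Hx.
assert (HPF := PF_subspace HF).
assert (Hv : forall m, PF P (vsum (fun i => vscal (g i x) (f i)) m)).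
{ intros m. apply vsum_mem; [assumption|]. intros i. now apply HPF. }
assert (Hd : forall m, PF P (vsub (vsum (fun i => vscal (g i x) (f i)) m) x)).
{ intros m. now apply subspace_sub. }
assert (Hp : forall y, PF P y -> 0 <= nrm s y) by (intros y Hy; now apply (FFamily_normed s HF)).
apply (Un_cv_of_norm (fun m => nrm s (vsub (vsum (fun i => vscal (g i x) (f i)) m) x)) _ _ (Rabs K)).
- apply Rabs_pos.
- intros m. rewrite <- (lin_on_vsum (PF P) h (fun i => g i x) f) by assumption.
  rewrite <- (@lin_on_sub V (PF P) h) by auto.
  eapply Rle_trans; [now apply HK|]. apply Rmult_le_compat_r; [auto | apply Rle_abs].
- auto.
- now apply Hexp.
Qed.

Theorem theorem3p4 (V : VSpace) (P : nat -> V -> Prop) (nrm : nat -> V -> R)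
  (Th : nat -> (nat -> R) -> Prop) (tn : nat -> (nat -> R) -> R)
  (g : nat -> V -> R) :
  FFamily P nrm ->
  @FFamily seqVS Th tn ->
  (forall s, exists lam, lamBK (Th s) (tn s) lam) ->
  F_frame P nrm Th tn g ->
  (* (a) *)
  (forall s, (forall i, exists h, is_ext P nrm s (g i) h) /\
     forall gs : nat -> V -> R, (forall i, is_ext P nrm s (g i) (gs i)) ->
       Banach_frame (P s) (nrm s) (Th s) (tn s) gs) /\
  (* (b) *)
  ((forall s, CB_space (Th s) (tn s)) ->
     exists f : nat -> V, DF_Bessel P nrm Th tn f /\
       exp_XF P nrm g f /\ exp_XFdual P nrm g f /\ exp_Xs P nrm g f) /\
  (* (c) *)
  ((forall s, CB_space (Th s) (tn s) /\ CB_space (dseq_mem (Th s) (tn s)) (dseq_norm (Th s) (tn s))) ->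
     exists f : nat -> V, pre_DF_frame P nrm Th tn f /\
       exp_XF P nrm g f /\ exp_XFdual P nrm g f /\ exp_Xs P nrm g f /\ exp_Xsdual P nrm g f) /\
  (* (d) *)
  ((forall s, CB_space (Th s) (tn s) /\ reflexive_seq (Th s) (tn s)) ->
     exists f : nat -> V, DF_frame P nrm Th tn f /\
       exp_XF P nrm g f /\ exp_XFdual P nrm g f /\ exp_Xs P nrm g f /\ exp_Xsdual P nrm g f).
Proof.
intros HF HFT Hlam [Hpre (U0 & MU0 & LU0 & BU0 & HU0)].
assert (HBK : forall s, BK_space (Th s) (tn s)).
{ intros s. destruct (Hlam s) as [lam H]. apply H. }
assert (Hloc := fun s => F_frame_extension P nrm Th tn g U0 s HF HFT
  (HBK s) Hpre MU0 LU0 (BU0 s) HU0).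
(* The canonical vectors lie in every [Th s], hence in Theta_F, so V applies to them and the same
   [f] works in (b), (c) and (d). *)
set (f := fun i => U0 (ecan i)).
assert (Hecan : forall i, @PF seqVS Th (ecan i)).
{ intros i s. destruct (Hlam s) as [lam (_ & H & _)]. apply H. }
assert (Hf : forall i, PF P (f i)) by (intros i; apply MU0, Hecan).
assert (HXs : (forall s, CB_space (Th s) (tn s)) -> exp_Xs P nrm g f).
{ intros HCB s gs Hgs x Hx.
  destruct (Hloc s) as (C & U & B & K & HC & HU & HUC & HUU0 & _ & Hu).
  specialize (Hu gs Hgs x Hx).
  assert (E : forall i, f i = U (ecan i)) by (intros i; now rewrite HUU0).
  pose proof (retract_expansion (HCB s) HC HU HUC E x Hx) as H. now rewrite Hu in H. }
assert (HXF : (forall s, CB_space (Th s) (tn s)) -> exp_XF P nrm g f).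
{ intros HCB x Hx s.
  destruct (Hloc s) as (C & U & B & K & _ & _ & _ & _ & Hext & _).
  pose proof (HXs HCB s _ Hext x (Hx s)) as H.
  replace (fun m => vsum (fun i => vscal (g i x) (f i)) m) with
    (fun m => vsum (fun i => vscal (C x i) (f i)) m); [exact H|].
  apply functional_extensionality. intros m. f_equal.
  apply functional_extensionality. intros i. f_equal. now apply Hext. }
assert (HXFd : (forall s, CB_space (Th s) (tn s)) -> exp_XFdual P nrm g f).
{ intros HCB. apply exp_XFdual_of_exp_XF; auto. }
assert (HXsd : (forall s, CB_space (Th s) (tn s)) -> (forall s, shrinking (Th s) (tn s)) ->
          exp_Xsdual P nrm g f).
{ intros HCB Hsh s gs Hgs h Hh.
  destruct (Hloc s) as (C & U & B & K & HC & HU & HUC & HUU0 & _ & Hu).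
  assert (E : forall i, f i = U (ecan i)) by (intros i; now rewrite HUU0).
  pose proof (retract_dual_expansion (FFamily_normed s HF) (HCB s) HC HU HUC E (Hsh s) h Hh) as H.
  intros eps Heps. destruct (H eps Heps) as [N HN]. exists N. intros m Hm.
  rewrite (dual_norm_ext _ _ _ (fun x => h x - rsum (fun i => h (f i) * C x i) m)); [now apply HN|].
  intros x Hx. now rewrite (Hu gs Hgs x Hx). }
split; [|split; [|split]].
- intros s. destruct (Hloc s) as (C & U & B & K & HC & HU & HUC & HUU0 & Hext & Hu). split.
  + intros i. exists (fun x => C x i). apply Hext.
  + intros gs Hgs. specialize (Hu gs Hgs).
    apply (Banach_frame_of_retract (P s) (nrm s) (Th s) (tn s) gs U B K);
      [now apply FFamily_normed | now apply (@FFamily_normed seqVS) | intros i; apply Hgs | | assumption |].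
    (* [C] agrees with the coordinates given by [gs] only on X_s, so its operator properties are
       transferred pointwise there. *)
    * destruct HC as (MC & LC & HB & BC). split; [|split; [|split; [assumption|]]].
      -- intros x Hx. rewrite <- Hu by assumption. auto.
      -- intros a b x y Hx Hy. rewrite <- !Hu; auto.
         apply subspace_lin; auto. apply (FFamily_normed s HF).
      -- intros x Hx. rewrite <- Hu by assumption. auto.
    * intros x Hx. rewrite <- Hu by assumption. auto.
- intros HCB. exists f. split; [|auto]. split; [assumption|]. intros s.
  destruct (Hloc s) as (C & U & B & K & HC & HU & HUC & HUU0 & _).
  apply (retract_dBessel (FFamily_normed s HF) (HCB s) HU).
  intros i. now rewrite HUU0.
- intros HCB. assert (HCB' := fun s => proj1 (HCB s)). exists f. split.
  + split; [assumption|]. intros s.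
    destruct (Hloc s) as (C & U & B & K & HC & HU & HUC & HUU0 & _).
    apply (retract_dFrame (FFamily_normed s HF) (HCB' s) HC HU HUC).
    intros i. now rewrite HUU0.
  + split; [auto|]. split; [auto|]. split; [auto|]. apply HXsd; [assumption|].
    intros s. apply CB_dual_shrinking; apply HCB.
- intros HCB. assert (HCB' := fun s => proj1 (HCB s)). exists f. split.
  + split; [assumption|]. intros s.
    destruct (Hloc s) as (C & U & B & K & HC & HU & HUC & HUU0 & _).
    apply (retract_dBanach_frame (FFamily_normed s HF) (HCB' s) HC HU HUC).
    intros i. now rewrite HUU0.
  + split; [auto|]. split; [auto|]. split; [auto|]. apply HXsd; [assumption|].
    intros s. destruct (Hlam s) as [lam Hl]. now apply (reflexive_shrinking (HCB' s) lam); [|apply HCB].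
Qed.
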